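(* Let $\mathfrak{N}_1$ and $\mathfrak{N}_2$ be properly infinite von Neumann algebras on a Hilbert space $\mathcal{H}$ such that $\mathfrak{N}_1 \subseteq \mathfrak{N}_2'$ and $X_1 X_2 \neq 0$ for all nonzero $X_1 \in \mathfrak{N}_1$ and nonzero $X_2 \in \mathfrak{N}_2$. Then for every unit vector $\Psi \in \mathcal{H}$ and every $\epsilon > 0$ there exists a unit vector $\Psi' \in \mathcal{H}$ with $\|\Psi - \Psi'\| < \epsilon$ such that the vector state $X \mapsto \langle \Psi', X\Psi'\rangle$ of $\mathfrak{N}_1 \vee \mathfrak{N}_2$ is an EPR state for incommensurable pairs.
   Context: $\mathfrak{N}'$ denotes the commutant, $\mathfrak{N}_1 \vee \mathfrak{N}_2$ the von Neumann algebra generated by $\mathfrak{N}_1$ and $\mathfrak{N}_2$, $[X,Y] = XY - YX$, $|X|^2 = X^*X$. For commuting self-adjoint operators $A_1, A_2$, a normal state $\omega$ is an EPR state for $(A_1, A_2)$ if $\omega((A_1 - A_2)^2) = 0$. A normal state $\omega$ of $\mathfrak{N}_1 \vee \mathfrak{N}_2$ is an EPR state for incommensurable pairs if there exist projections $E_1, F_1 \in \mathfrak{N}_1$ and $E_2, F_2 \in \mathfrak{N}_2$ such that $\omega$ is an EPR state for $(E_1,E_2)$ and for $(F_1,F_2)$, $\omega(|[E_1,F_1]|^2) \neq 0$, and $\omega(|[E_2,F_2]|^2) \neq 0$. *)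

(* Defs.v *)
From mathcomp Require Import all_boot all_algebra.
From mathcomp Require Import reals.
From mathcomp Require Import complex.
Set Implicit Arguments. Unset Strict Implicit. Unset Printing Implicit Defensive.
Import GRing.Theory Num.Theory.
Local Open Scope ring_scope.
Local Open Scope complex_scope.

Section Hilbert.
Variable R : realType.
Variable H : lmodType R[i].
(* inner product, physics convention: conjugate-linear in the first argument,
   linear in the second *)
Variable ip : H -> H -> R[i].

Definition hnorm (x : H) : R := Num.sqrt (complex.Re (ip x x)).

Definition cauchy_seq (u : nat -> H) : Prop :=
  forall e : R, 0 < e -> exists N : nat, forall m n : nat,
    (N <= m)%N -> (N <= n)%N -> hnorm (u m - u n) < e.

Definition converges_to (u : nat -> H) (l : H) : Prop :=
  forall e : R, 0 < e -> exists N : nat, forall n : nat,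
    (N <= n)%N -> hnorm (u n - l) < e.

Record is_hilbert : Prop := IsHilbert {
  ip_linear : forall (a : R[i]) (x y z : H), ip x (a *: y + z) = a * ip x y + ip x z;
  ip_conj : forall x y : H, ip y x = (ip x y)^*;
  ip_ge0 : forall x : H, 0 <= ip x x;
  ip_eq0 : forall x : H, ip x x = 0 -> x = 0;
  ip_complete : forall u : nat -> H, cauchy_seq u -> exists l : H, converges_to u l
}.

Definition op := H -> H.
Definition opM (A B : op) : op := fun x => A (B x).
Definition opB (A B : op) : op := fun x => A x - B x.
Definition commutator (A B : op) : op := opB (opM A B) (opM B A).
Definition op_nonzero (A : op) : Prop := exists x : H, A x <> 0.

Definition bounded_op (A : op) : Prop :=
  (forall (a : R[i]) (x y : H), A (a *: x + y) = a *: A x + A y) /\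
  exists c : R, forall x : H, hnorm (A x) <= c * hnorm x.

Definition adjoint_of (A B : op) : Prop := forall x y : H, ip (A x) y = ip x (B y).

Definition commutant (S : op -> Prop) : op -> Prop :=
  fun B => bounded_op B /\ forall A, S A -> forall x, B (A x) = A (B x).

Definition vN_algebra (M : op -> Prop) : Prop :=
  (forall A, M A -> bounded_op A) /\
  (forall A, M A -> exists B, M B /\ adjoint_of A B) /\
  (forall A, M A <-> commutant (commutant M) A).

Definition projection (P : op) : Prop :=
  bounded_op P /\ (forall x, P (P x) = P x) /\ adjoint_of P P.

Definition central_projection (M : op -> Prop) (P : op) : Prop :=
  M P /\ commutant M P /\ projection P.

(* P is infinite in M: P ~ Q (Murray-von Neumann, via V in M with V*V = P, VV* = Q)
   for some projection Q <= P with Q <> P *)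
Definition infinite_in (M : op -> Prop) (P : op) : Prop :=
  projection P /\
  exists V W : op, M V /\ M W /\ adjoint_of V W /\
    (forall x, W (V x) = P x) /\
    (forall x, P (V (W x)) = V (W x)) /\
    exists x, V (W x) <> P x.

Definition properly_infinite (M : op -> Prop) : Prop :=
  vN_algebra M /\ op_nonzero (fun x => x) /\
  forall P, central_projection M P -> op_nonzero P -> infinite_in M P.

Definition vstate (v : H) (X : op) : R[i] := ip v (X v).

Definition epr_for (v : H) (A1 A2 : op) : Prop :=
  vstate v (opM (opB A1 A2) (opB A1 A2)) = 0.

(* omega(|X|^2) = omega(X^* X), which for the vector state is <X v, X v> *)
Definition vstate_abs2 (v : H) (X : op) : R[i] := ip (X v) (X v).

Definition epr_incommensurable (N1 N2 : op -> Prop) (v : H) : Prop :=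
  exists E1 F1 E2 F2 : op,
    N1 E1 /\ N1 F1 /\ N2 E2 /\ N2 F2 /\
    projection E1 /\ projection F1 /\ projection E2 /\ projection F2 /\
    epr_for v E1 E2 /\ epr_for v F1 F2 /\
    vstate_abs2 v (commutator E1 F1) <> 0 /\
    vstate_abs2 v (commutator E2 F2) <> 0.

End Hilbert.

(* Main.v *)
(* An infinite identity gives a proper isometry V in each N_i, and with it an
   infinite sequence of orthogonal projections, each carrying 2x2 matrix units;
   Q_i is a member of the sequence with Q_i Psi small.  The Schlieder property
   yields y <> 0 fixed by the diagonal units E_1 and E_2, and y + U_1 U_2 y is then
   maximally entangled: it is an EPR vector for (E_1, E_2) and for the
   projections onto the diagonals, which do not commute with the E_i.  All these
   projections annihilate (1 - Q_1)(1 - Q_2) Psi, so adding a small multiple of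
   the entangled vector to it and normalizing gives Psi'. *)
Require Import Defs.
From mathcomp Require Import all_boot all_order all_algebra.
From mathcomp Require Import reals.
From mathcomp Require Import complex.
From mathcomp Require Import lra.
Import Order.TTheory GRing.Theory Num.Theory.
Local Open Scope ring_scope.

(** The real part keeps all norm estimates inside the ordered field [R]. *)
Definition re_ip {R : realType} {H : lmodType R[i]} (ip : H -> H -> R[i]) (x y : H) : R :=
  complex.Re (ip x y).

Set Implicit Arguments.
(** In matrix notation [E] is e11, [U] is e21 and [W], the adjoint of [U], is e12; the unit e22 is
    [U W], orthogonal to [E] because [E U = 0]. *)
Record matrix_units {R : realType} {H : lmodType R[i]} (ip : H -> H -> R[i])
  (N : op H -> Prop) (E U W : op H) : Prop := MatrixUnits {
  mu_E : N E;
  mu_U : N U;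
  mu_W : N W;
  mu_adjE : adjoint_of ip E E;
  mu_adjU : adjoint_of ip U W;
  mu_EE : forall x, E (E x) = E x;
  mu_WU : forall x, W (U x) = E x;
  mu_UE : forall x, U (E x) = U x;
  mu_EW : forall x, E (W x) = W x;
  mu_EU : forall x, E (U x) = 0;
  mu_WE : forall x, W (E x) = 0
}.
Unset Implicit Arguments.

(* (E + U)(E + W) / 2, the projection onto the diagonal {y + U y | y in ran E} *)
Definition diagonal_projection {R : realType} {H : lmodType R[i]} (E U W : op H) : op H :=
  fun x => (2^-1 : R)%:C%C *: (E (E x + W x) + U (E x + W x)).

(** * Inner product, norm and normalization estimates *)

Section InnerProduct.
Context {R : realType} {H : lmodType R[i]} {ip : H -> H -> R[i]}.
Hypothesis hilb : is_hilbert ip.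

Local Notation norm := (hnorm ip).
Local Notation rip := (re_ip ip).

Lemma ipDr x y z : ip x (y + z) = ip x y + ip x z.
Proof. by rewrite -[y]scale1r (ip_linear hilb) mul1r scale1r. Qed.

Lemma ip0r x : ip x 0 = 0.
Proof. by apply: (addrI (ip x 0)); rewrite -ipDr !addr0. Qed.

Lemma ipZr a x y : ip x (a *: y) = a * ip x y.
Proof. by rewrite -[a *: y]addr0 (ip_linear hilb) ip0r addr0. Qed.

Lemma ipBr x y z : ip x (y - z) = ip x y - ip x z.
Proof. by rewrite ipDr -scaleN1r ipZr mulN1r. Qed.

Lemma ipDl x y z : ip (x + y) z = ip x z + ip y z.
Proof. by rewrite (ip_conj hilb) ipDr rmorphD /= -!(ip_conj hilb). Qed.

Lemma ipBl x y z : ip (x - y) z = ip x z - ip y z.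
Proof. by rewrite (ip_conj hilb) ipBr rmorphB /= -!(ip_conj hilb). Qed.

Lemma ripC x y : rip x y = rip y x.
Proof. by rewrite /re_ip (ip_conj hilb); case: (ip y x). Qed.

Lemma ripDr x y z : rip x (y + z) = rip x y + rip x z.
Proof. by rewrite /re_ip ipDr; case: (ip x y); case: (ip x z). Qed.

Lemma ripBr x y z : rip x (y - z) = rip x y - rip x z.
Proof. by rewrite /re_ip ipBr; case: (ip x y); case: (ip x z). Qed.

Lemma ripZr (a : R) x y : rip x (a%:C%C *: y) = a * rip x y.
Proof. by rewrite /re_ip ipZr; case: (ip x y) => u v /=; rewrite mul0r subr0. Qed.

Lemma ripBl x y z : rip (x - y) z = rip x z - rip y z.
Proof. by rewrite ripC ripBr !(ripC z). Qed.

Lemma ripZl (a : R) x y : rip (a%:C%C *: x) y = a * rip x y.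
Proof. by rewrite ripC ripZr ripC. Qed.

Lemma ripDl x y z : rip (x + y) z = rip x z + rip y z.
Proof. by rewrite ripC ripDr !(ripC z). Qed.

Lemma rip_ge0 x : 0 <= rip x x.
Proof. by have := ip_ge0 hilb x; rewrite lecE => /andP[_]. Qed.

Lemma sqr_norm x : norm x ^+ 2 = rip x x.
Proof. by rewrite sqr_sqrtr // rip_ge0. Qed.

Lemma norm_ge0 x : 0 <= norm x.
Proof. exact: sqrtr_ge0. Qed.

Lemma normZ (a : R) x : norm (a%:C%C *: x) = `|a| * norm x.
Proof.
by rewrite /hnorm -!/(rip _ _) ripZl ripZr mulrA -expr2 sqrtrM ?sqr_ge0 // sqrtr_sqr.
Qed.

Lemma normN x : norm (- x) = norm x.
Proof.
have -> : - x = ((-1 : R)%:C)%C *: x by rewrite rmorphN rmorph1 scaleN1r.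
by rewrite normZ normrN normr1 mul1r.
Qed.

Lemma norm_eq0 x : norm x = 0 -> x = 0.
Proof.
move=> x0; apply: (ip_eq0 hilb); have := sqr_norm x; rewrite x0 expr0n /re_ip.
(* Nonnegativity in [R[i]] includes a vanishing imaginary part, so the real part determines
   [ip x x]. *)
have := ip_ge0 hilb x; rewrite lecE => /andP[/eqP im0 _] re0.
by apply/eqP; rewrite eq_complex im0 -re0 !eqxx.
Qed.

Lemma rip_le_norm x y : rip x y <= norm x * norm y.
Proof.
have [x0|x0] := eqVneq (norm x) 0.
  by rewrite x0 mul0r (norm_eq0 _ x0) ripC /re_ip ip0r.
have [y0|y0] := eqVneq (norm y) 0.
  by rewrite y0 mulr0 (norm_eq0 _ y0) /re_ip ip0r.
have xy : 0 < norm x * norm y.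
  by rewrite mulr_gt0 // lt_def ?x0 ?y0 norm_ge0.
(* This square expands to [2 |x| |y| (|x| |y| - rip x y)], and [|x| |y| > 0]. *)
have := rip_ge0 ((norm y)%:C%C *: x - (norm x)%:C%C *: y).
rewrite ripBl !ripBr !ripZl !ripZr (ripC y x) -!sqr_norm => h.
by rewrite -(ler_pM2l xy); nra.
Qed.

Lemma norm_triangle x y : norm (x + y) <= norm x + norm y.
Proof.
rewrite -(@ler_pXn2r _ 2) ?nnegrE ?addr_ge0 ?norm_ge0 //.
rewrite sqr_norm ripDl !ripDr (ripC y x) sqrrD !sqr_norm.
by have := rip_le_norm x y; lra.
Qed.

Lemma norm_triangle_sub x y : norm (x - y) <= norm x + norm y.
Proof. by rewrite -(normN y) norm_triangle. Qed.

(** Dividing [y] by its norm moves it by [| |y| - 1 |], which is at most [|x - y|] since [|x| = 1];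
    hence the factor 2. The bound [e <= 1] keeps [y] away from 0. *)
Lemma near_unit_normalize x y (e : R) :
    norm x = 1 -> e <= 1 -> norm (x - y) < e / 2 ->
  exists a : R, [/\ a != 0, norm (a%:C%C *: y) = 1 & norm (x - a%:C%C *: y) < e].
Proof.
move=> x1 e1 xy.
have h1 : 1 <= norm (x - y) + norm y.
  by have := norm_triangle (x - y) y; rewrite subrK x1.
have h2 : norm y <= norm (x - y) + 1.
  by have := norm_triangle_sub x (x - y); rewrite opprB addrCA subrr addr0 x1 addrC.
have y0 : 0 < norm y by lra.
have a0 : (norm y)^-1 != 0 by rewrite invr_eq0 gt_eqF.
exists (norm y)^-1; split => //.
  by rewrite normZ gtr0_norm ?invr_gt0 // mulVf // gt_eqF.
have -> : x - ((norm y)^-1)%:C%C *: y =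
    (x - y) + (1 - (norm y)^-1)%:C%C *: y.
  by rewrite rmorphB rmorph1 scalerBl scale1r addrA subrK.
apply: le_lt_trans (norm_triangle _ _) _.
rewrite normZ -{2}(gtr0_norm y0) -normrM mulrBl mul1r mulVf ?gt_eqF //.
suff : `|norm y - 1| <= norm (x - y) by lra.
by rewrite ler_norml; apply/andP; split; lra.
Qed.

Lemma adjoint_of_sym (A B : op H) : adjoint_of ip A B -> adjoint_of ip B A.
Proof. by move=> h x y; rewrite (ip_conj hilb) -h -(ip_conj hilb). Qed.

Lemma rip_adj {A B : op H} : adjoint_of ip A B -> forall x y, rip (A x) y = rip x (B y).
Proof. by move=> h x y; rewrite /re_ip h. Qed.

Lemma norm_projection_le (P : op H) x : projection ip P -> norm (P x) <= norm x.
Proof.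
case=> _ [PP Pa]; rewrite -(@ler_pXn2r _ 2) ?nnegrE ?norm_ge0 // !sqr_norm.
(* Pythagoras: this square equals [|x|^2 - |P x|^2]. *)
have := rip_ge0 (x - P x).
by rewrite ripBl !ripBr !(rip_adj Pa) PP; lra.
Qed.

(** * Bounded linear operators *)

Section BoundedLinear.
Context {A : op H}.
Hypothesis bA : bounded_op ip A.

Lemma opD x y : A (x + y) = A x + A y.
Proof. by case: bA => h _; rewrite -[x in LHS]scale1r h scale1r. Qed.

Lemma op0 : A 0 = 0.
Proof. by apply: (addrI (A 0)); rewrite -opD !addr0. Qed.

Lemma opZ a x : A (a *: x) = a *: A x.
Proof. by case: bA => h _; rewrite -[a *: x]addr0 h op0 addr0. Qed.

Lemma opBr x y : A (x - y) = A x - A y.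
Proof. by rewrite opD -scaleN1r opZ scaleN1r. Qed.

End BoundedLinear.

Lemma bounded_op_id : bounded_op ip (fun x => x).
Proof. by split=> //; exists 1 => x; rewrite mul1r. Qed.

Lemma bounded_op_comp A B :
  bounded_op ip A -> bounded_op ip B -> bounded_op ip (fun x => A (B x)).
Proof.
move=> bA bB; split=> [a x y|]; first by rewrite (opD bB) (opZ bB) (opD bA) (opZ bA).
(* The constant [c] has no prescribed sign, so [|c|] is used to multiply the bound for [B]. *)
case: bA bB => _ [c hc] [_ [d hd]]; exists (`|c| * d) => x.
apply: le_trans (hc _) _; apply: le_trans (_ : `|c| * norm (B x) <= _).
  by rewrite ler_wpM2r ?norm_ge0 ?ler_norm.
by rewrite -mulrA ler_wpM2l.
Qed.

Lemma bounded_op_add A B :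
  bounded_op ip A -> bounded_op ip B -> bounded_op ip (fun x => A x + B x).
Proof.
move=> bA bB; split=> [a x y|].
  by rewrite (opD bB) (opZ bB) (opD bA) (opZ bA) scalerDr addrACA.
case: bA bB => _ [c hc] [_ [d hd]]; exists (c + d) => x.
by rewrite mulrDl (le_trans (norm_triangle _ _)) ?lerD.
Qed.

Lemma bounded_op_sub A B :
  bounded_op ip A -> bounded_op ip B -> bounded_op ip (fun x => A x - B x).
Proof.
move=> bA bB; split=> [a x y|].
  by rewrite (opD bB) (opZ bB) (opD bA) (opZ bA) scalerBr opprD addrACA.
case: bA bB => _ [c hc] [_ [d hd]]; exists (c + d) => x.
by rewrite mulrDl (le_trans (norm_triangle_sub _ _)) ?lerD.
Qed.

Lemma bounded_op_scale (a : R) A :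
  bounded_op ip A -> bounded_op ip (fun x => a%:C%C *: A x).
Proof.
move=> bA; split=> [b x y|].
  by rewrite (opD bA) (opZ bA) scalerDr !scalerA mulrC.
case: bA => _ [c hc]; exists (`|a| * c) => x.
by rewrite normZ -mulrA ler_wpM2l.
Qed.

(** * Closure properties of a von Neumann algebra *)

Section VNAlgebra.
Context {N : op H -> Prop}.
Hypothesis vN : vN_algebra ip N.

Lemma vN_bounded A : N A -> bounded_op ip A.
Proof. by case: vN => h _; apply: h. Qed.

(** The double commutant reduces each closure property below to boundedness and a commutation
    identity. *)
Lemma vN_bicommutant A : bounded_op ip A ->
  (forall C, commutant ip N C -> forall x, A (C x) = C (A x)) -> N A.
Proof. by case: vN => _ [_ h] bA hA; apply/h. Qed.

Lemma vN_commute A C : N A -> commutant ip N C -> forall x, A (C x) = C (A x).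
Proof. by move=> nA [_ h] x; rewrite h. Qed.

Lemma vN_id : N (fun x => x).
Proof. by apply: vN_bicommutant => //; apply: bounded_op_id. Qed.

Lemma vN_comp A B : N A -> N B -> N (fun x => A (B x)).
Proof.
move=> nA nB; apply: vN_bicommutant => [|C hC x].
  by apply: bounded_op_comp; apply: vN_bounded.
by rewrite (vN_commute _ _ nB hC) (vN_commute _ _ nA hC).
Qed.

Lemma vN_add A B : N A -> N B -> N (fun x => A x + B x).
Proof.
move=> nA nB; apply: vN_bicommutant => [|C hC x].
  by apply: bounded_op_add; apply: vN_bounded.
by rewrite (vN_commute _ _ nB hC) (vN_commute _ _ nA hC) (opD (proj1 hC)).
Qed.

Lemma vN_sub A B : N A -> N B -> N (fun x => A x - B x).
Proof.
move=> nA nB; apply: vN_bicommutant => [|C hC x].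
  by apply: bounded_op_sub; apply: vN_bounded.
by rewrite (vN_commute _ _ nB hC) (vN_commute _ _ nA hC) (opBr (proj1 hC)).
Qed.

Lemma vN_scale (a : R) A : N A -> N (fun x => a%:C%C *: A x).
Proof.
move=> nA; apply: vN_bicommutant => [|C hC x].
  by apply: bounded_op_scale; apply: vN_bounded.
by rewrite (vN_commute _ _ nA hC) (opZ (proj1 hC)).
Qed.

(** * Matrix units from a proper isometry, with small support at a given vector *)

Lemma vN_iter A k : N A -> N (iter k A).
Proof.
move=> nA; elim: k => [|k IH]; first exact: vN_id.
exact: (vN_comp A (iter k A)).
Qed.

Lemma iter_adjoint A B k : adjoint_of ip A B -> adjoint_of ip (iter k A) (iter k B).
Proof. by move=> h; elim: k => //= k IH x y; rewrite h IH -iterSr. Qed.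

(** If each of the first [Num.bound (a 0 / e)] steps, a number exceeding [a 0 / e], dropped by at
    least [e], the sequence would become negative. *)
Lemma small_decrement (a : nat -> R) (e : R) :
  (forall k, 0 <= a k) -> 0 < e -> exists k, a k - a k.+1 < e.
Proof.
move=> a0 e0; case: (boolP [exists k : 'I_(Num.bound (a 0 / e)), a k - a k.+1 < e]).
  by case/existsP => k hk; exists k.
rewrite negb_exists => /forallP h; exfalso.
have : forall k, (k <= Num.bound (a 0 / e))%N -> a k <= a 0 - k%:R * e.
  elim=> [|k IH] hk; first by rewrite mul0r subr0.
  have := h (Ordinal hk); rewrite -leNgt /= => hk'.
  by have := IH (ltnW hk); rewrite -natr1 mulrDl mul1r; lra.
move=> /(_ _ (leqnn _)) hb.
have := archi_boundP (divr_ge0 (a0 0) (ltW e0)).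
rewrite ltr_pdivrMr // => hc.
by have := a0 (Num.bound (a 0 / e)); lra.
Qed.

(* Conjugating by A = V^(2k) gives orthogonal copies of the pair of equivalent
   projections 1 - V V^*, V (1 - V V^* ) V^*; their sums Q_k are orthogonal, so
   Q_k Psi tends to 0. *)
Lemma small_matrix_units (Psi : H) (e : R) :
    infinite_in ip N (fun x => x) -> 0 < e ->
  exists E U W Q, [/\ matrix_units ip N E U W, op_nonzero E &
    [/\ N Q, projection ip Q, norm (Q Psi) < e,
        forall x, E (Q x) = E x & forall x, W (Q x) = W x]].
Proof.
case=> _ [V [V' [nV [nV' [aV [V'V [_ [x0 hx0]]]]]]]] e0.
have bV := vN_bounded _ nV; have bV' := vN_bounded _ nV'.
(* Squaring the isometry leaves room in the complement of its range for two equivalent orthogonal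
   projections. *)
pose S x := V (V x); pose T x := V' (V' x).
have nS : N S by apply: vN_comp.
have nT : N T by apply: vN_comp.
have aS : adjoint_of ip S T by move=> x y; rewrite /S /T !aV.
have TS x : T (S x) = x by rewrite /T /S !V'V.
(* For this [k] the decrement is exactly the squared norm of [Q Psi], with [Q] as defined below. *)
have [k hk] := small_decrement (fun k => norm (iter k T Psi) ^+ 2) (e ^+ 2)
  (fun k => sqr_ge0 _) (exprn_gt0 2 e0).
pose A := iter k S; pose B := iter k T.
have nA : N A by apply: vN_iter.
have nB : N B by apply: vN_iter.
have bA := vN_bounded _ nA; have bB := vN_bounded _ nB.
have aA : adjoint_of ip A B by apply: iter_adjoint.
have BA x : B (A x) = x.
  by rewrite /A /B; elim: (k) x => // j IH x; rewrite iterSr /= TS IH.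
have aV' := adjoint_of_sym _ _ aV; have aB := adjoint_of_sym _ _ aA.
(* [D] projects onto the complement of the range of [V]; it is nonzero, since [V V'] moves [x0]. *)
pose D x := x - V (V' x).
have nD : N D by apply: (vN_sub _ _ vN_id); apply: vN_comp.
have bD := vN_bounded _ nD.
have V'D x : V' (D x) = 0 by rewrite /D (opBr bV') V'V subrr.
have DV x : D (V x) = 0 by rewrite /D V'V subrr.
have DD x : D (D x) = D x by rewrite {1}/D V'D (op0 bV) subr0.
have aD : adjoint_of ip D D by move=> x y; rewrite /D ipBl ipBr aV aV'.
(* [C = D + V D V'], the sum of the two diagonal units before conjugation by [A]. *)
pose C x := x - S (T x).
have nC : N C by apply: (vN_sub _ _ vN_id); apply: vN_comp.
have bC := vN_bounded _ nC.
have CC x : C (C x) = C x.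
  by rewrite /C (opBr (vN_bounded _ nT)) TS subrr (op0 (vN_bounded _ nS)) subr0.
have aC : adjoint_of ip C C.
  by move=> x y; rewrite /C ipBl ipBr aS (adjoint_of_sym _ _ aS).
have DC x : D (C x) = D x.
  by rewrite {1}/C (opBr bD) /S DV subr0.
have V'C x : D (V' (C x)) = D (V' x).
  by rewrite /C (opBr bV') /S V'V (opBr bD) DV subr0.
pose Q x := A (C (B x)).
have nQ : N Q by do 2!apply: vN_comp => //.
(* These are the units [D], [V D] and [D V'] conjugated by [A], whose adjoint is [B]. *)
exists (fun x => A (D (B x))), (fun x => A (V (D (B x)))),
  (fun x => A (D (V' (B x)))), Q; split.
- split=> [|||x y|x y|x|x|x|x|x|x].
  + by do 2!apply: (vN_comp) => //.
  + by apply: (vN_comp _ (fun x => V (D (B x)))) => //; do 2!apply: vN_comp => //.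
  + by apply: (vN_comp _ (fun x => D (V' (B x)))) => //; do 2!apply: vN_comp => //.
  + by rewrite aA aD aB.
  + by rewrite aA aV aD aB.
  + by rewrite BA DD.
  + by rewrite BA V'V DD.
  + by rewrite BA DD.
  + by rewrite BA DD.
  + by rewrite BA DV (op0 bA).
  + by rewrite BA V'D (op0 bD) (op0 bA).
- exists (A x0) => h; apply: hx0; apply/esym/eqP; rewrite -subr_eq0.
  by rewrite -/(D x0) -[D x0]BA -{1}[x0]BA h (op0 bB).
split.
- exact: nQ.
- split; first exact: vN_bounded.
  by split=> [x|x y]; rewrite /Q ?BA ?CC // aA aC aB.
- rewrite -(@ltr_pXn2r _ 2) ?nnegrE ?norm_ge0 ?(ltW e0) //.
  apply: le_lt_trans hk; rewrite iterS -/B !sqr_norm /Q.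
  rewrite (rip_adj aA) BA (rip_adj aC) CC /C ripBr.
  by rewrite -(rip_adj (adjoint_of_sym _ _ aS)).
- by move=> x; rewrite BA DC.
- by move=> x; rewrite BA V'C.
Qed.

(** * The diagonal projection and its commutator with [E] *)

Section DiagonalProjection.
Context {E U W : op H}.
Hypothesis mu : matrix_units ip N E U W.
Local Notation F := (diagonal_projection E U W).

Lemma diagonal_projectionE x :
  F x = (2^-1 : R)%:C%C *: (E x + W x + (U x + U (W x))).
Proof.
rewrite /diagonal_projection (opD (vN_bounded _ (mu_E mu))) (mu_EE mu) (mu_EW mu).
by rewrite (opD (vN_bounded _ (mu_U mu))) (mu_UE mu).
Qed.

Lemma diagonal_projection_mem : N F.
Proof.
have nG : N (fun x => E x + W x) by apply: vN_add; [case: mu|case: mu].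
apply: (vN_scale _ (fun x => E (E x + W x) + U (E x + W x))).
by apply: vN_add; apply: (vN_comp _ (fun x => E x + W x)) => //; case: mu.
Qed.

Lemma diagonal_projectionP : projection ip F.
Proof.
have nF := diagonal_projection_mem.
have bE := vN_bounded _ (mu_E mu); have bU := vN_bounded _ (mu_U mu).
have bW := vN_bounded _ (mu_W mu).
split; first exact: vN_bounded.
split=> [x|x y].
  rewrite {2}/diagonal_projection /diagonal_projection.
  (* [F x] is half of [g + U g], and [E + W] sends that half back to [g], one half of [g] coming
     from each summand; so [F] is idempotent. *)
  set g := E x + W x.
  have Eg : E g = g by rewrite (opD bE) (mu_EE mu) (mu_EW mu).
  rewrite Eg.
  have Wg : W g = 0 by rewrite -Eg (mu_WE mu).
  have -> : E ((2^-1)%:C%C *: (g + U g)) + W ((2^-1)%:C%C *: (g + U g)) = g.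
    rewrite (opZ bE) (opZ bW) -scalerDr (opD bE) (opD bW) Eg Wg.
    rewrite (mu_EU mu) (mu_WU mu) Eg addr0 add0r -mulr2n -scaler_nat scalerA.
    by rewrite -(rmorph_nat (real_complex R)) -rmorphM mulVf ?pnatr_eq0 // scale1r.
  by rewrite Eg.
have aW := adjoint_of_sym _ _ (mu_adjU mu).
rewrite /diagonal_projection (ip_conj hilb) !ipZr rmorphM /= -(ip_conj hilb).
(* Conjugating the real scalar leaves an imaginary part [- 0]. What remains says that [E + U] and
   [E + W] are mutually adjoint. *)
congr (_ * _); first by rewrite oppr0.
by rewrite ipDl (mu_adjE mu) (mu_adjU mu) -ipDr ipDl (mu_adjE mu) aW -ipDr.
Qed.

(** In coordinates [(a, b)], [E] is the matrix [[1,0],[0,0]] and [F] is half of [[1,1],[1,1]], so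
    the commutator is half of [[0,1],[-1,0]]. *)
Lemma matrix_units_entangled z a b : E z = 0 -> W z = 0 -> E a = a -> E b = b ->
  [/\ E (z + (a + U b)) = a,
      F (z + (a + U b)) = (2^-1 : R)%:C%C *: (a + b + (U a + U b)) &
      commutator E F (z + (a + U b)) = (2^-1 : R)%:C%C *: (b - U a)].
Proof.
move=> Ez Wz Ea Eb.
have bE := vN_bounded _ (mu_E mu); have bU := vN_bounded _ (mu_U mu).
have bW := vN_bounded _ (mu_W mu).
have Wa : W a = 0 by rewrite -Ea (mu_WE mu).
have Ezab : E (z + (a + U b)) = a.
  by rewrite !(opD bE) Ez Ea (mu_EU mu) add0r addr0.
have Wzab : W (z + (a + U b)) = b.
  by rewrite !(opD bW) Wz Wa (mu_WU mu) Eb !add0r.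
have Uzab : U (z + (a + U b)) = U a by rewrite -(mu_UE mu) Ezab.
have Fzab : F (z + (a + U b)) = (2^-1 : R)%:C%C *: (a + b + (U a + U b)).
  by rewrite diagonal_projectionE Ezab Wzab Uzab.
split => //; rewrite /commutator /opB /opM Fzab Ezab diagonal_projectionE Ea Wa.
rewrite (opZ bE) !(opD bE) Ea Eb !(mu_EU mu) (op0 bU) !addr0 -scalerBr.
by rewrite opprD addrACA subrr add0r.
Qed.

End DiagonalProjection.
End VNAlgebra.

(** * The maximally entangled vector of two commuting systems of matrix units *)

Section Entangled.
Context {N1 N2 : op H -> Prop}.
Hypotheses (vN1 : vN_algebra ip N1) (vN2 : vN_algebra ip N2).
Hypothesis N12 : forall A, N1 A -> commutant ip N2 A.

Lemma commuting_ops A B : N1 A -> N2 B -> forall x, A (B x) = B (A x).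
Proof. by move=> nA nB; case: (N12 _ nA) => _; apply. Qed.

(** The vector has coordinates [(y, U2 y)] for the first system and [(y, U1 y)] for the second. Both
    [E_i] send it to [y], both diagonal projections to half of [y + U1 y + U2 y + U1 U2 y], and the
    commutators to half of [U2 y - U1 y], up to sign. *)
Lemma maximally_entangled_epr E1 U1 W1 E2 U2 W2 z y :
    matrix_units ip N1 E1 U1 W1 -> matrix_units ip N2 E2 U2 W2 ->
    E1 z = 0 -> W1 z = 0 -> E2 z = 0 -> W2 z = 0 ->
    E1 y = y -> E2 y = y -> y <> 0 ->
  epr_incommensurable ip N1 N2 (z + (y + U1 (U2 y))).
Proof.
move=> mu1 mu2 E1z W1z E2z W2z E1y E2y y0.
have E1U2y : E1 (U2 y) = U2 y by rewrite (commuting_ops _ _ (mu_E mu1) (mu_U mu2)) E1y.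
have E2U1y : E2 (U1 y) = U1 y by rewrite -(commuting_ops _ _ (mu_U mu1) (mu_E mu2)) E2y.
have [Ey1 Fy1 cy1] := matrix_units_entangled vN1 mu1 _ _ _ E1z W1z E1y E1U2y.
have [Ey2 Fy2 cy2] := matrix_units_entangled vN2 mu2 _ _ _ E2z W2z E2y E2U1y.
have Uy : U1 (U2 y) = U2 (U1 y) := commuting_ops _ _ (mu_U mu1) (mu_U mu2) y.
have neqU : U1 y - U2 y <> 0.
  (* Equality would give [y = W2 U2 y = W2 U1 y = U1 W2 E2 y = 0]. *)
  move=> /subr0_eq eqU; apply: y0; rewrite -E2y -(mu_WU mu2) -eqU.
  rewrite -(commuting_ops _ _ (mu_U mu1) (mu_W mu2)) -E2y (mu_WE mu2).
  exact: op0 (vN_bounded vN1 _ (mu_U mu1)).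
have half0 : (2^-1 : R)%:C%C != 0 :> R[i].
  by rewrite fmorph_eq0 invr_eq0 pnatr_eq0.
have epr0 A1 A2 v : N1 A1 -> N2 A2 -> A1 v = A2 v -> epr_for ip v A1 A2.
  move=> n1 n2 h; rewrite /epr_for /vstate /opM /opB h subrr.
  rewrite (op0 (vN_bounded vN1 _ n1)) (op0 (vN_bounded vN2 _ n2)) subrr.
  exact: ip0r.
have nF1 := diagonal_projection_mem vN1 mu1.
have nF2 := diagonal_projection_mem vN2 mu2.
have pE N E U W : vN_algebra ip N -> matrix_units ip N E U W -> projection ip E.
  move=> vN mu; split; first exact: (vN_bounded vN _ (mu_E mu)).
  by split; [exact: mu_EE mu|exact: mu_adjE mu].
exists E1, (diagonal_projection E1 U1 W1), E2, (diagonal_projection E2 U2 W2).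
split; first exact: mu_E mu1.
split; first exact: nF1.
split; first exact: mu_E mu2.
split; first exact: nF2.
split; first exact: pE vN1 mu1.
split; first exact: (diagonal_projectionP vN1 mu1).
split; first exact: pE vN2 mu2.
split; first exact: (diagonal_projectionP vN2 mu2).
split; first by apply: epr0 (mu_E mu1) (mu_E mu2) _; rewrite Ey1 Uy Ey2.
split.
  apply: epr0 nF1 nF2 _; rewrite Fy1 [in RHS]Uy Fy2 Uy; congr (_ *: _).
  by rewrite !addrA; congr (_ + _); rewrite -!addrA (addrC (U2 y)).
split => /(ip_eq0 hilb) /eqP; last rewrite Uy.
  by rewrite cy1 scaler_eq0 (negPf half0) /= -opprB oppr_eq0 => /eqP.
by rewrite cy2 scaler_eq0 (negPf half0) /= => /eqP.
Qed.

End Entangled.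
End InnerProduct.

(** * Perturbing [Psi] into an EPR vector *)

Lemma properly_infinite_id {R : realType} {H : lmodType R[i]} {ip : H -> H -> R[i]}
    {N : op H -> Prop} : is_hilbert ip ->
  properly_infinite ip N -> vN_algebra ip N /\ infinite_in ip N (fun x => x).
Proof.
move=> hilb [vN [id0 h]]; split=> //; apply: h => //; split; last split.
- exact: vN_id vN.
- by split; first exact: bounded_op_id.
- by split; first exact: bounded_op_id.
Qed.

Theorem theorem3 (R : realType) (H : lmodType R[i]) (ip : H -> H -> R[i])
  (N1 N2 : op H -> Prop) :
  is_hilbert ip ->
  properly_infinite ip N1 -> properly_infinite ip N2 ->
  (forall A, N1 A -> commutant ip N2 A) ->
  (forall X1 X2, N1 X1 -> N2 X2 -> op_nonzero X1 -> op_nonzero X2 ->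
     op_nonzero (opM X1 X2)) ->
  forall Psi : H, hnorm ip Psi = 1 ->
  forall eps : R, 0 < eps ->
  exists Psi' : H, hnorm ip Psi' = 1 /\ hnorm ip (Psi - Psi') < eps /\
    epr_incommensurable ip N1 N2 Psi'.
Proof.
move=> hilb pi1 pi2 N12 schlieder Psi Psi1 eps eps0.
have [vN1 inf1] := properly_infinite_id hilb pi1.
have [vN2 inf2] := properly_infinite_id hilb pi2.
have [e [e0 e1 e_eps]] : exists e : R, [/\ 0 < e, e <= 1 & e <= eps].
  by case: (leP eps 1) => h; [exists eps | exists 1; split => //; apply: ltW].
(* Four error terms, [Q1 Psi], [Q2 Psi], [Q1 (Q2 Psi)] and the entangled part, share the budget
   [e / 2]. *)
have d0 : 0 < e / 8 by rewrite divr_gt0.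
have [E1 [U1 [W1 [Q1 [mu1 E1n0 [nQ1 pQ1 Q1s EQ1 WQ1]]]]]] :=
  small_matrix_units hilb vN1 Psi _ inf1 d0.
have [E2 [U2 [W2 [Q2 [mu2 E2n0 [nQ2 pQ2 Q2s EQ2 WQ2]]]]]] :=
  small_matrix_units hilb vN2 Psi _ inf2 d0.
have [x0 hx0] := schlieder _ _ (mu_E mu1) (mu_E mu2) E1n0 E2n0.
have cEE := commuting_ops N12 _ _ (mu_E mu1) (mu_E mu2).
pose y := E1 (E2 x0).
have E1y : E1 y = y by rewrite /y (mu_EE mu1).
have E2y : E2 y = y by rewrite /y cEE (mu_EE mu2).
have bQ1 := vN_bounded vN1 _ nQ1; have bQ2 := vN_bounded vN2 _ nQ2.
pose v := Psi - Q2 Psi; pose chi := v - Q1 v.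
(* Either factor [1 - Q_i] can be put outermost, so that operators of both algebras supported under
   [Q_i] kill [chi]. *)
have chiE : chi = (Psi - Q1 Psi) - Q2 (Psi - Q1 Psi).
  rewrite /chi /v (opBr bQ1) (opBr bQ2) (commuting_ops N12 _ _ nQ1 nQ2).
  by rewrite !opprD !opprK !addrA (addrAC Psi).
have kill1 A : N1 A -> (forall x, A (Q1 x) = A x) -> A chi = 0.
  by move=> nA AQ; rewrite /chi (opBr (vN_bounded vN1 _ nA)) AQ subrr.
have kill2 A : N2 A -> (forall x, A (Q2 x) = A x) -> A chi = 0.
  by move=> nA AQ; rewrite chiE (opBr (vN_bounded vN2 _ nA)) AQ subrr.
pose Phi := y + U1 (U2 y).
(* Adding 1 avoids division by zero and makes the bound [|d Phi| < e / 8] strict. *)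
pose d : R := e / 8 / (1 + hnorm ip Phi).
have Phi0 : 0 < 1 + hnorm ip Phi by have := norm_ge0 (ip := ip) Phi; lra.
have dn0 : d != 0 by rewrite gt_eqF // divr_gt0.
have close : hnorm ip (Psi - (chi + d%:C%C *: Phi)) < e / 2.
  have -> : Psi - (chi + d%:C%C *: Phi) = (Q2 Psi + Q1 Psi) - (Q1 (Q2 Psi) + d%:C%C *: Phi).
    by rewrite /chi /v (opBr bQ1) !opprD !opprK !addrA subrr add0r.
  have h1 := norm_triangle_sub hilb (Q2 Psi + Q1 Psi) (Q1 (Q2 Psi) + d%:C%C *: Phi).
  have h2 := norm_triangle hilb (Q2 Psi) (Q1 Psi).
  have h3 := norm_triangle hilb (Q1 (Q2 Psi)) (d%:C%C *: Phi).
  have h4 := norm_projection_le hilb Q1 (Q2 Psi) pQ1.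
  have h5 : hnorm ip (d%:C%C *: Phi) < e / 8.
    rewrite (normZ hilb) gtr0_norm ?divr_gt0 // /d mulrAC ltr_pdivrMr //.
    by rewrite ltr_pM2l //; lra.
  by lra.
have [a [a0 an close']] := near_unit_normalize hilb _ _ _ Psi1 e1 close.
exists (a%:C%C *: (chi + d%:C%C *: Phi)); split => //; split.
  exact: lt_le_trans close' e_eps.
have bU1 := vN_bounded vN1 _ (mu_U mu1); have bU2 := vN_bounded vN2 _ (mu_U mu2).
(* Linearity moves the scalar [a d] onto [y], giving the form [z + (y + U1 (U2 y))] with [a chi] for
   [z] and [a d y] for [y]. *)
rewrite scalerDr scalerA !(scalerDr (a%:C%C * d%:C%C)) -(opZ bU1) -(opZ bU2).
set c := (_ * _)%R.
have bE1 := vN_bounded vN1 _ (mu_E mu1); have bE2 := vN_bounded vN2 _ (mu_E mu2).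
have bW1 := vN_bounded vN1 _ (mu_W mu1); have bW2 := vN_bounded vN2 _ (mu_W mu2).
apply: (maximally_entangled_epr hilb vN1 vN2 N12 _ _ _ _ _ _ _ _ mu1 mu2).
- by rewrite (opZ bE1) (kill1 _ (mu_E mu1) EQ1) scaler0.
- by rewrite (opZ bW1) (kill1 _ (mu_W mu1) WQ1) scaler0.
- by rewrite (opZ bE2) (kill2 _ (mu_E mu2) EQ2) scaler0.
- by rewrite (opZ bW2) (kill2 _ (mu_W mu2) WQ2) scaler0.
- by rewrite (opZ bE1) E1y.
- by rewrite (opZ bE2) E2y.
- move=> /eqP; rewrite scaler_eq0 /c mulf_eq0 !fmorph_eq0 (negPf a0) (negPf dn0).
  by move=> /eqP.
Qed.
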